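(* Let $n\geqslant 2$ be an integer and let $q\in L$ be a proper element which is $k$-potent $\delta$-primary for some integer $k$ with $2\leqslant k\leqslant n$. Then $q$ is $\phi$-$\delta$-primary for some function $\phi:L\to L$ with $\phi\leqslant\phi_n$ if and only if $q$ is $\delta$-primary.
   Context: A multiplicative lattice is a complete lattice (least element $0$, greatest element $1$) with a commutative, associative multiplication that distributes over arbitrary joins and for which $1$ is the identity. An element $a$ is compact if $a\leqslant \bigvee X$ with $X\subseteq L$ implies $a\leqslant a_1\vee\dots\vee a_m$ for finitely many $a_i\in X$; $L$ is compactly generated if every element is a join of compact elements. Standing assumptions: $L$ is a compactly generated multiplicative lattice in which $1$ is compact and every finite product of compact elements is compact; $\delta:L\to L$ is an expansion function, i.e. $a\leqslant\delta(a)$ for all $a$, and $a\leqslant b$ implies $\delta(a)\leqslant\delta(b)$. An element $p$ is proper if $p<1$. A proper element $p$ is $\delta$-primary if for all $a,b\in L$, $ab\leqslant p$ implies $a\leqslant p$ or $b\leqslant\delta(p)$. For an integer $k\geqslant 2$, a proper element $p$ is $k$-potent $\delta$-primary if for all $a,b\in L$, $ab\leqslant p^k$ implies $a\leqslant p$ or $b\leqslant\delta(p)$. For $\phi:L\to L$, a proper element $p$ is $\phi$-$\delta$-primary if for all $a,b\in L$, $ab\leqslant p$ and $ab\not\leqslant\phi(p)$ implies $a\leqslant p$ or $b\leqslant\delta(p)$. $\phi_n(a)=a^n$, and $\gamma_1\leqslant\gamma_2$ for functions $L\to L$ means $\gamma_1(a)\leqslant\gamma_2(a)$ for all $a\in L$.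 *)

(* Defs.v *)
From HB Require Import structures.
From mathcomp Require Import all_boot all_order.
From mathcomp Require Import boolp classical_sets.

Set Implicit Arguments.
Unset Strict Implicit.
Unset Printing Implicit Defensive.

Import Order.TTheory.

Local Open Scope classical_set_scope.
Local Open Scope group_scope.
Local Open Scope order_scope.

(* The lattice structure provides the least element \bot and the greatest
   element \top; completeness amounts to the existence of arbitrary joins. *)
HB.mixin Record hasBigJoin (d : Order.disp_t) L of Order.TBLattice d L := {
  bigjoin : set L -> L;
  bigjoinP : forall X : set L, supremums X (bigjoin X)
}.

#[short(type="completeLatticeType")]
HB.structure Definition CompleteLattice (d : Order.disp_t) :=
  {L of hasBigJoin d L & Order.TBLattice d L}.

(* Associativity and the identity laws come from the monoid structure, whose
   identity 1 is required to be \top.  Taking X = set0 in mulg_bigjoin gives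
   a * \bot = \bot. *)
HB.mixin Record isMultiplicativeLattice (d : Order.disp_t) L
    of CompleteLattice d L & Monoid L := {
  mulgC : commutative (@mul L);
  oneg_top : 1%g = \top :> L;
  mulg_bigjoin : forall (a : L) (X : set L),
    a * bigjoin X = bigjoin [set a * x | x in X]
}.

#[short(type="multLatticeType")]
HB.structure Definition MultLattice (d : Order.disp_t) :=
  {L of isMultiplicativeLattice d L & CompleteLattice d L & Monoid L}.

Section Definitions.
Context {d : Order.disp_t} {L : multLatticeType d}.
Implicit Types (a b p : L) (X : set L) (delta phi : L -> L).

(* The empty finite join is allowed, so that \bot is compact. *)
Definition compact_elt a : Prop :=
  forall X, a <= bigjoin X ->
    exists s : seq L, (forall x, x \in s -> X x) /\ a <= \join_(x <- s) x.

Definition expansion_function delta : Prop :=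
  (forall a, a <= delta a) /\ (forall a b, a <= b -> delta a <= delta b).

Definition proper_elt p : Prop := p < \top.

Definition delta_primary delta p : Prop :=
  proper_elt p /\
  forall a b, a * b <= p -> a <= p \/ b <= delta p.

Definition potent_delta_primary (k : nat) delta p : Prop :=
  proper_elt p /\
  forall a b, a * b <= p ^+ k -> a <= p \/ b <= delta p.

Definition phi_delta_primary phi delta p : Prop :=
  proper_elt p /\
  forall a b, a * b <= p -> ~ (a * b <= phi p) -> a <= p \/ b <= delta p.

Definition phi_pow (n : nat) : L -> L := fun a => a ^+ n.

End Definitions.

Definition compactly_generated (d : Order.disp_t) (L : multLatticeType d) :
    Prop :=
  forall a : L,
    exists X : set L, (forall x, X x -> compact_elt x) /\ a = bigjoin X.

(* The empty product is 1, so this includes compactness of 1 = \top. *)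
Definition compact_prod_closed (d : Order.disp_t) (L : multLatticeType d) :
    Prop :=
  forall s : seq L, (forall x, x \in s -> compact_elt x) ->
    compact_elt (\prod_(x <- s) x)%g.

(* Main.v *)
Require Import Defs.
From mathcomp Require Import all_boot all_order.
From mathcomp Require Import boolp classical_sets.

(** In a multiplicative lattice a product lies below each of its factors,
    so the powers of [q] decrease: [q ^+ n <= q ^+ k] whenever [k <= n].
    Hence, when [phi <= phi_pow n] and [q] is [k]-potent [delta]-primary with
    [k <= n], the products that [phi]-[delta]-primality leaves out, those below
    [phi q], lie below [q ^+ k], which is where [k]-potency decides.  The two
    hypotheses thus cover every product below [q].  Conversely, a
    [delta]-primary element is [phi]-[delta]-primary for every [phi], for
    instance [phi_pow n] itself. *)

Import Order.TTheory.

(** Distributivity over the join of [b] and [\top] gives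
    [a = a * \top = a * b \/ a], with [\/] the join. *)
Lemma mulg_le_left (d : Order.disp_t) (L : multLatticeType d) (a b : L) :
  (a * b <= a)%O%g.
Proof.
have join_top : bigjoin [set b; \top%O]%classic = \top%O :> L.
  apply/le_anti; rewrite lex1 /=.
  by case: (bigjoinP [set b; \top%O : L]%classic) => ub _; apply: ub; right.
have := mulg_bigjoin a [set b; \top%O]%classic.
rewrite join_top -oneg_top mulg1 => {2}->.
case: (bigjoinP [set (a * x)%g | x in [set b; 1%g : L]]%classic) => ub _.
by apply: ub; exists b => //; left.
Qed.

Lemma expg_antitone (d : Order.disp_t) (L : multLatticeType d) (a : L)
    (k n : nat) : (k <= n)%N -> (a ^+ n <= a ^+ k)%O%g.
Proof. by move=> /subnKC <-; rewrite expgnDr mulg_le_left. Qed.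

Theorem theorem2p28 (d : Order.disp_t) (L : multLatticeType d)
    (L_cg : compactly_generated L)
    (top_compact : compact_elt (\top%O : L))
    (prod_compact : compact_prod_closed L)
    (delta : L -> L) (delta_exp : expansion_function delta)
    (n : nat) (hn : (2 <= n)%N)
    (q : L) (q_proper : proper_elt q)
    (q_potent : exists k : nat,
        (2 <= k <= n)%N /\ potent_delta_primary k delta q) :
  (exists phi : L -> L,
      (phi <= phi_pow n)%O /\ phi_delta_primary phi delta q)
  <-> delta_primary delta q.
Proof.
split=> [[phi [phi_le [_ q_phi]]]|[_ q_primary]]; last first.
  by exists (phi_pow n); split=> //; split=> // a b ab_q _; apply: q_primary.
have [k [/andP[_ le_kn] [_ q_pot]]] := q_potent.
split=> // a b ab_q.
have [ab_phi|ab_nphi] := pselect (a * b <= phi q)%O%g; last exact: q_phi.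
apply: q_pot; apply: le_trans ab_phi _.
apply: (@le_trans _ _ (q ^+ n)%g); last exact: expg_antitone.
by move/lefP: phi_le; apply.
Qed.
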